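(* Let $H$ be a separable Hilbert space over $\mathbb{C}$ with orthonormal basis $f_1, f_2, \ldots$ (indexed by the positive integers), and let $n$ be a positive integer. Let $\mathcal{S}_n(\mathbb{N})$ be the set of all $n$-tuples $\sigma = (\sigma_1,\ldots,\sigma_n)$ of positive integers with $\sigma_1 < \cdots < \sigma_n$. For each $\sigma \in \mathcal{S}_n(\mathbb{N})$, let $H_\sigma$ be the subspace spanned by $f_{\sigma_1},\ldots,f_{\sigma_n}$, let $E_\sigma : H_\sigma \to H$ be the inclusion, and let $P_\sigma : H \to H_\sigma$ be the orthogonal projection of $H$ onto $H_\sigma$. Let $U, W$ be finite-dimensional vector spaces over $\mathbb{C}$ and let $B : U \to H$ and $A : H \to W$ be continuous linear maps. Then: (1) As linear maps $\bigwedge^n W \to \bigwedge^n U$, $$(AB)^* = \sum_{\sigma \in \mathcal{S}_n(\mathbb{N})} (P_\sigma B)^* (A E_\sigma)^*.$$ (2) If $W = U$ has dimension $n$, and if for each $\sigma \in \mathcal{S}_n(\mathbb{N})$ the map $\phi_\sigma : H_\sigma \to U$ is any linear bijection, then $$(AB)^* = \sum_{\sigma \in \mathcal{S}_n(\mathbb{N})} (\phi_\sigma P_\sigma B)^* (A E_\sigma \phi_\sigma^{-1})^*.$$ (3) In particular, in the situation of (2), $$\det(AB) = \sum_{\sigma \in \mathcal{S}_n(\mathbb{N})} \det(\phi_\sigma P_\sigma B)\, \det(A E_\sigma \phi_\sigma^{-1}).$$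
   Context: For a complex Hilbert space (or finite-dimensional complex vector space) $X$, $\bigwedge^n X$ denotes the space of all continuous alternating $n$-linear (over $\mathbb{C}$) functionals $\omega : X^n \to \mathbb{C}$ (continuity is automatic in finite dimensions). For a continuous linear map $F : X \to Y$, the $n$-th level dual $F^* : \bigwedge^n Y \to \bigwedge^n X$ is the linear map defined by $F^*\omega[x_1,\ldots,x_n] = \omega[Fx_1,\ldots,Fx_n]$. The infinite sums over the countable set $\mathcal{S}_n(\mathbb{N})$ are understood as unconditionally convergent sums: in (1) and (2) in the finite-dimensional space of linear maps $\bigwedge^n W \to \bigwedge^n U$, and in (3) in $\mathbb{C}$. The determinant of a linear map $F: U \to U$ with $\dim U = n$ is the usual one, equivalently the scalar by which $F^*$ acts on the one-dimensional space $\bigwedge^n U$. *)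

(* Defs.v *)
From HB Require Import structures.
From mathcomp Require Import all_boot all_order all_algebra.
From mathcomp Require Import complex.
From mathcomp Require Import all_classical all_reals all_analysis.
From mathcomp.analysis.showcase Require summability.

Set Implicit Arguments.
Unset Strict Implicit.
Unset Printing Implicit Defensive.

Import Order.TTheory GRing.Theory Num.Theory passmx.
Import numFieldNormedType.Exports.

Local Open Scope classical_set_scope.
Local Open Scope ring_scope.

Section FiniteDimension.
Variables (K : fieldType) (V : lmodType K) (W : vectType K).
Variable g : {linear V -> W}.
Hypothesis g_inj : injective g.

Let inimg (L : {vspace W}) := forall x, x \in L -> exists v, g v = x.

Lemma image_vspace : exists L : {vspace W}, inimg L /\ forall v, g v \in L.
Proof.
pose P d := `[< exists2 L : {vspace W}, \dim L = d & inimg L >].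
have P0 : exists d, P d.
  exists 0%N; apply/asboolP; exists 0%VS; first by rewrite dimv0.
  by move=> x; rewrite memv0 => /eqP ->; exists 0; rewrite linear0.
have Pub d : P d -> (d <= \dim {:W})%N.
  by move=> /asboolP[L <- _]; rewrite dimvS// subvf.
case: (ex_maxnP P0 Pub) => d /asboolP[L dL imL] dmax.
exists L; split=> // v; apply: contraT => gvL.
have : P (\dim (L + <[g v]>)%VS).
  apply/asboolP; exists (L + <[g v]>)%VS => // x.
  case/memv_addP => y /imL[w <-] [z /vlineP[k ->] ->].
  by exists (w + k *: v); rewrite linearD linearZ.
move=> /dmax; rewrite -dL => le_d.
have eqL : (L == L + <[g v]>)%VS by rewrite eqEdim addvSl.
move: gvL; rewrite (eqP eqL) => /negP[].
by apply: (subvP (addvSr _ _)); rewrite memv_line.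
Qed.

Lemma finite_dim_of_injective : {d & Vector.axiom d V}.
Proof.
have [L [imL gL]] := cid image_vspace.
exists (\dim L).
pose h v : 'rV[K]_(\dim L) := \row_i coord (vbasis L) i (g v).
exists h.
  by move=> a u v; apply/rowP => i; rewrite !mxE !linearP.
have hK (r : 'rV[K]_(\dim L)) : {v | h v = r}.
  pose x := \sum_i r 0 i *: (vbasis L)`_i.
  have xL : x \in L.
    by apply: memv_suml => i _; rewrite memvZ// vbasis_mem// mem_nth// size_tuple.
  have [v gv] := cid (imL x xL); exists v.
  by apply/rowP => i; rewrite mxE gv coord_sum_free// (basis_free (vbasisP L)).
exists (fun r => sval (hK r)) => [v|r]; last by case: (hK r).
case: (hK (h v)) => w /= /rowP hw; apply: g_inj.
rewrite (coord_vbasis (gL w)) (coord_vbasis (gL v)).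
by apply: eq_bigr => i _; have := hw i; rewrite !mxE => ->.
Qed.

End FiniteDimension.

Section AlternatingForms.
Variables (K : fieldType) (n : nat).

Definition multilinear (X : lmodType K) (w : ('I_n -> X) -> K^o) :=
  forall (x : 'I_n -> X) (i : 'I_n) (a : K) (u v : X),
    w [eta x with i |-> a *: u + v] =
    a *: w [eta x with i |-> u] + w [eta x with i |-> v].

Definition alternating (X : lmodType K) (w : ('I_n -> X) -> K^o) :=
  forall (x : 'I_n -> X) (i j : 'I_n), i != j -> x i = x j -> w x = 0.

Definition altpred (X : lmodType K) : {pred (('I_n -> X) -> K^o)} :=
  fun w => `[< multilinear w /\ alternating w >].

Lemma altpred_submod (X : lmodType K) : submod_closed (@altpred X).
Proof.
split.
  by apply/asboolP; split=> [x i a u v|x i j _ _] //; rewrite /GRing.zero/= scaler0 addr0.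
move=> a w1 w2 /asboolP[m1 a1] /asboolP[m2 a2]; apply/asboolP; split.
  move=> x i b u v.
  rewrite -![(a *: w1 + w2) _]/(a *: w1 _ + w2 _) m1 m2.
  by rewrite !scalerDr !scalerA [a * b]mulrC addrACA.
move=> x i j ij xij.
by rewrite -[(a *: w1 + w2) _]/(a *: w1 _ + w2 _) (a1 _ _ _ ij xij)
   (a2 _ _ _ ij xij) scaler0 addr0.
Qed.

HB.instance Definition _ (X : lmodType K) :=
  GRing.isSubmodClosed.Build K _ (@altpred X) (altpred_submod X).

(* All the spaces X below are finite-dimensional, so that continuity of an
   alternating form is automatic. *)
Record altform (X : vectType K) := AltForm {
  altval :> ('I_n -> X) -> K^o;
  altvalP : altval \in @altpred X }.

HB.instance Definition _ (X : vectType K) := [isSub for @altval X].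
HB.instance Definition _ (X : vectType K) := [Choice of altform X by <:].
HB.instance Definition _ (X : vectType K) :=
  [SubChoice_isSubLmodule of altform X by <:].

Section VectorStructure.
Variable X : vectType K.
Let e := vbasis {:X}.
Let values (w : altform X) : {ffun {ffun 'I_n -> 'I_(\dim {:X})} -> K^o} :=
  [ffun k : {ffun 'I_n -> 'I_(\dim {:X})} => w (fun i => e`_(k i))].

Let values_linear : linear values.
Proof. by move=> a w1 w2; apply/ffunP => k; rewrite !ffunE. Qed.

HB.instance Definition _ := GRing.isLinear.Build K _ _ _ values values_linear.

Let values_injective : injective values.
Proof.
apply: raddf_inj => w w0; apply: val_inj; apply/funext => x.
have /asboolP[wl _] := altvalP w.
pose basic m := forall x : 'I_n -> X,
  (forall i : 'I_n, (m <= i)%N -> exists j : 'I_(\dim {:X}), x i = e`_j) -> w x = 0.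
suff: basic n by apply=> i; rewrite leqNgt ltn_ord.
have: (n <= n)%N by [].
elim: {-2}n => [_ y yb|m IH ltmn y yb].
  have [k ky] := choice (fun i => yb i (leq0n _)).
  have /ffunP/(_ (finfun k)) := w0; rewrite !ffunE => <-; congr (altval w _).
  by apply/funext => i; rewrite ky ffunE.
pose i0 := Ordinal ltmn.
have yE : y = [eta y with i0 |-> y i0].
  by apply/funext => i /=; case: eqP => [->|].
have sum0 (s : seq 'I_(\dim {:X})) c :
    w [eta y with i0 |-> \sum_(j <- s) c j *: e`_j] = 0.
  elim: s => [|j s IHs].
    have := wl y i0 0 0 0; rewrite big_nil !scale0r addr0 add0r => ->.
    apply: (addrI (w [eta y with i0 |-> 0])).
    have := wl y i0 1 0 0; rewrite !scale1r addr0 => <-; rewrite addr0 //.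
  rewrite big_cons wl IHs addr0 IH ?scaler0 // ?(ltnW ltmn)// => i lemi /=.
  case: eqP => [_|/eqP nei]; first by exists j.
  apply: yb; rewrite ltn_neqAle lemi andbT.
  by apply: contraNneq nei => eqmi; apply/eqP/val_inj.
by rewrite yE (coord_vbasis (memvf (y i0))) sum0.
Qed.

HB.instance Definition _ :=
  let fd := finite_dim_of_injective values_injective in
  Lmodule_hasFinDim.Build K (altform X) (projT2 fd).

End VectorStructure.

Section Pullback.
Variables (X Y : vectType K) (F : {linear X -> Y}).

Lemma comp_altpred (w : altform Y) :
  (fun x : 'I_n -> X => w (F \o x)) \in @altpred X.
Proof.
have /asboolP[wl wa] := altvalP w; apply/asboolP; split.
  have upd x i u : F \o [eta x with i |-> u] = [eta F \o x with i |-> F u].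
    by apply/funext => j /=; case: eqP.
  by move=> x i a u v; rewrite !upd linearP wl.
by move=> x i j ij xij; apply: (wa _ _ _ ij); rewrite /= xij.
Qed.

Definition pullback_fun (w : altform Y) : altform X := AltForm (comp_altpred w).

Lemma pullback_fun_linear : linear pullback_fun.
Proof. by move=> a w1 w2; apply: val_inj; apply/funext => x. Qed.

HB.instance Definition _ :=
  GRing.isLinear.Build K _ _ _ pullback_fun pullback_fun_linear.

Definition pullback : 'Hom(altform Y, altform X) := linfun pullback_fun.

Lemma pullbackE (w : altform Y) (x : 'I_n -> X) :
  pullback w x = w (F \o x).
Proof. by rewrite lfunE. Qed.

End Pullback.
End AlternatingForms.

Arguments pullback {K} n%_N {X Y} F%_function_scope.

Definition ldet (K : fieldType) (U : vectType K) (F : {linear U -> U}) : K :=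
  \det (mxof (vbasis {:U}) (vbasis {:U}) (linfun F)).

(* [fdspace V] is [V] with its canonical vector space topology, that is, the
   topology transported from the space of coordinate rows in some basis. *)
Definition fdspace (K : numFieldType) (V : vectType K) : Type :=
  initial_topology (rVof (vbasis {:V}) : V -> 'rV[K]_(\dim {:V})).

HB.instance Definition _ (K : numFieldType) (V : vectType K) :=
  Vector.copy (fdspace V) V.
HB.instance Definition _ (K : numFieldType) (V : vectType K) :=
  Topological.copy (fdspace V)
    (initial_topology (rVof (vbasis {:V}) : V -> 'rV[K]_(\dim {:V}))).

(* Unconditional summability: convergence of the net of finite partial sums. *)
Definition has_sum (I : choiceType) (V : PreTopologicalZmodule.type)
    (u : I -> V) (l : V) : Prop :=
  summability.partial_sum u @ summability.totally --> l.

HB.mixin Record hasInnerProduct (R : realType) H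
    of CompleteNormedModule R[i] H := {
  inner : {dot H for (@Num.conj R[i])};
  inner_norm : forall x, `|x| ^+ 2 = inner x x }.

#[short(type="hilbertType")]
HB.structure Definition Hilbert (R : realType) :=
  { H of hasInnerProduct R H & CompleteNormedModule R[i] H }.

Notation "'[ x , y ]" := (inner x y) : ring_scope.

(* Indexing starts at 0: [f k] is the (k+1)-st basis vector. *)
Record orthonormal_basis (R : realType) (H : hilbertType R) := OrthonormalBasis {
  basis_vec :> nat -> H;
  basis_orthonormal : forall i j, '[basis_vec i, basis_vec j] = (i == j)%:R;
  basis_total :
    closure [set x | exists m (c : 'I_m -> R[i]),
                       x = \sum_(k < m) c k *: basis_vec k] = setT }.

Definition increasing_tuple (n : nat) := {s : n.-tuple nat | sorted ltn s}.

Section CoordinateSubspace.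
Variables (R : realType) (H : hilbertType R) (f : orthonormal_basis H).
Variables (n : nat) (s : increasing_tuple n).

Definition coord_pred : {pred H} :=
  fun x => `[< exists c : 'I_n -> R[i], x = \sum_i c i *: f (tnth (val s) i) >].

Lemma coord_pred_submod : submod_closed coord_pred.
Proof.
split.
  by apply/asboolP; exists (fun=> 0); rewrite big1// => i _; rewrite scale0r.
move=> a x y /asboolP[c ->] /asboolP[d ->]; apply/asboolP.
exists (fun i => a * c i + d i); rewrite scaler_sumr -big_split/=.
by apply: eq_bigr => i _; rewrite scalerDl scalerA.
Qed.

HB.instance Definition _ :=
  GRing.isSubmodClosed.Build R[i] H coord_pred coord_pred_submod.

Record coord_subspace := CoordSubspace {
  coord_val : H;
  coord_valP : coord_val \in coord_pred }.

HB.instance Definition _ := [isSub for coord_val].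
HB.instance Definition _ := [Choice of coord_subspace by <:].
HB.instance Definition _ := [SubChoice_isSubLmodule of coord_subspace by <:].

Definition inclusion : {linear coord_subspace -> H} := \val.

Definition inner_row (x : H) : 'rV[R[i]]_n := \row_i '[x, f (tnth (val s) i)].

Lemma inner_row_linear : linear inner_row.
Proof. by move=> a x y; apply/rowP => i; rewrite !mxE linearPl. Qed.

Lemma inner_row_sum (c : 'I_n -> R[i]) :
  inner_row (\sum_i c i *: f (tnth (val s) i)) = \row_i c i.
Proof.
apply/rowP => i; rewrite !mxE linear_sumlz (bigD1 i)//=.
rewrite linearZl_LR /= basis_orthonormal eqxx mulr1 big1 ?addr0// => j nij.
rewrite linearZl_LR /= basis_orthonormal.
have /lt_sorted_uniq : sorted <%O (val (val s)) := valP s.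
rewrite (tnth_nth 0%N) (tnth_nth 0%N) => us.
by rewrite nth_uniq ?size_tuple// (inj_eq val_inj) (negPf nij) mulr0.
Qed.

Definition coordinates (x : coord_subspace) := inner_row (coord_val x).

Lemma coordinates_linear : linear coordinates.
Proof. by move=> a x y; rewrite /coordinates -inner_row_linear. Qed.

HB.instance Definition _ :=
  GRing.isLinear.Build R[i] coord_subspace _ _ coordinates coordinates_linear.

Lemma coordinates_injective : injective coordinates.
Proof.
move=> x y; have /asboolP[c cx] := coord_valP x.
have /asboolP[d dy] := coord_valP y.
rewrite /coordinates cx dy !inner_row_sum => /rowP cd.
apply: val_inj; rewrite -[val x]/(coord_val x) cx -[val y]/(coord_val y) dy.
by apply: eq_bigr => i _; have := cd i; rewrite !mxE => ->.
Qed.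

HB.instance Definition _ :=
  let fd := finite_dim_of_injective coordinates_injective in
  Lmodule_hasFinDim.Build R[i] coord_subspace (projT2 fd).

Lemma orthogonal_projection_exists : exists P : {linear H -> coord_subspace},
  forall x y, '[x - inclusion (P x), inclusion y] = 0.
Proof.
pose p x := \sum_i inner_row x 0 i *: f (tnth (val s) i).
have pP x : p x \in coord_pred by apply/asboolP; exists (inner_row x 0).
pose P x := CoordSubspace (pP x).
have P_linear : linear P.
  move=> a x y; apply: val_inj; rewrite linearP /= /p inner_row_linear.
  rewrite scaler_sumr -big_split/=.
  by apply: eq_bigr => i _; rewrite !mxE scalerDl scalerA.
pose Pm := GRing.isLinear.Build R[i] H coord_subspace _ P P_linear.
pose PL : {linear H -> coord_subspace} := HB.pack P Pm.
exists PL => x y.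
have z0 i : '[x - inclusion (PL x), f (tnth (val s) i)] = 0.
  rewrite linearBl.
  have /rowP/(_ i) := inner_row_sum (inner_row x 0); rewrite !mxE => pxi.
  by apply/eqP; rewrite subr_eq0; apply/eqP; exact: (esym pxi).
move: z0; move: (x - inclusion (PL x)) => z z0.
have /asboolP[c cy] := coord_valP y.
rewrite -[inclusion y]/(coord_val y) cy linear_sumr big1// => i _.
by rewrite linearZr_LR /= z0 mulr0.
Qed.

Definition projection : {linear H -> coord_subspace} :=
  sval (cid orthogonal_projection_exists).

Lemma projectionP x y : '[x - inclusion (projection x), inclusion y] = 0.
Proof. exact: (svalP (cid orthogonal_projection_exists)). Qed.

End CoordinateSubspace.

(* Main.v *)
(* Everything reduces to a scalar statement: for an alternating form w on W and
   vectors h_1, ..., h_n of H, the sum over s of w(A E_s P_s h_i) converges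
   unconditionally to w(A h_i).  With a_j = A f_j and b_ij = <h_i, f_j>,
   expanding w multilinearly shows that the terms whose indices are below N sum
   to the sum over injective k : {1..n} -> {1..N} of
   (prod_i b_{i,k_i}) w(a_{k_1}, ..., a_{k_n}),
   that is, to w applied to the A-images of the N-th Fourier sums of the h_i;
   by continuity of A this tends to w(A h_i).  The absolute values are
   dominated by a product over i of sums over j of |b_ij| |a_j|, bounded because
   both the b_ij (Bessel) and the coordinates of the a_j (Bessel for a continuous
   functional) are square summable in j.  Part (1) follows since finitely many
   evaluations separate the points of Hom(/\^n W, /\^n U); in (2) the bijections
   phi_s cancel, and (3) is the scalar statement for the determinant form. *)
Require Import Defs.
From HB Require Import structures.
From mathcomp Require Import all_boot all_order all_algebra.
From mathcomp Require Import finmap complex.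
From mathcomp Require Import all_classical all_reals all_analysis.

Set Implicit Arguments.
Unset Strict Implicit.
Unset Printing Implicit Defensive.

Import Order.TTheory GRing.Theory Num.Theory passmx.
Import numFieldNormedType.Exports.

Local Open Scope classical_set_scope.
Local Open Scope ring_scope.

(** * Expansion of multilinear and alternating maps on linear combinations *)

Section MultilinearExpansion.
Variable K : fieldType.

(** Induction on [n]: slot [ord0] is expanded first, and with its vector fixed the map in the other
    slots is again multilinear. *)
Lemma multilinear_sum (n : nat) (X : lmodType K) (J : finType)
    (w : ('I_n -> X) -> K^o) (c : 'I_n -> J -> K) (g : J -> X) :
  multilinear w ->
  w (fun i => \sum_j c i j *: g j) =
  \sum_(k : {ffun 'I_n -> J}) (\prod_i c i (k i)) * w (g \o k).
Proof.
elim: n => [|n IH] in w c *; move=> wl.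
  pose k0 : {ffun 'I_0 -> J} := ffun0 (card_ord 0).
  rewrite (bigD1 k0)//= big_ord0 mul1r.
  rewrite big1 => [|k /eqP[]]; last by apply/ffunP => -[].
  by rewrite addr0; congr w; apply/funext => -[].
pose cons y (x : 'I_n -> X) i := oapp x y (unlift ord0 i).
have upd0 y x u : cons u x = [eta cons y x with ord0 |-> u].
  by apply/funext => i /=; rewrite /cons; case: unliftP => [j|] -> //=; rewrite ?eqxx.
have updS y x i u : cons y [eta x with i |-> u] =
    [eta cons y x with lift ord0 i |-> u].
  apply/funext => j /=; rewrite /cons; case: unliftP => [l|] -> /=.
    by rewrite (inj_eq lift_inj).
  by [].
have w'l y : multilinear (fun x => w (cons y x)).
  by move=> x i a u v; rewrite !updS wl.
have w0 x (s : seq J) :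
    w (cons (\sum_(j <- s) c ord0 j *: g j) x) =
    \sum_(j <- s) c ord0 j * w (cons (g j) x).
  have wl0 a u v : w (cons (a *: u + v) x) = a * w (cons u x) + w (cons v x).
    by rewrite (upd0 0 x (a *: u + v)) (upd0 0 x u) (upd0 0 x v) wl.
  elim: s => [|j s IHs]; last by rewrite !big_cons wl0 IHs.
  (* Linearity at [1 *: 0 + 0] shows that [w] vanishes when a slot is zero. *)
  rewrite !big_nil; apply: (addrI (w (cons 0 x))).
  by rewrite addr0 -[X in X + _]mul1r -wl0 scale1r add0r.
have -> : (fun i => \sum_j c i j *: g j) =
    cons (\sum_j c ord0 j *: g j) (fun i => \sum_j c (lift ord0 i) j *: g j).
  by apply/funext => i; rewrite /cons; case: unliftP => [j|] ->.
rewrite w0.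
under eq_bigr do rewrite (IH _ _ (w'l _)) mulr_sumr.
rewrite pair_big /=.
pose h (p : J * {ffun 'I_n -> J}) : {ffun 'I_n.+1 -> J} :=
  [ffun i => oapp p.2 p.1 (unlift ord0 i)].
rewrite [RHS](reindex h) /=; last first.
  exists (fun k => (k ord0, [ffun i => k (lift ord0 i)])) => [[j k] _|k _].
    by rewrite /h ffunE unlift_none; congr (_, _); apply/ffunP => i; rewrite !ffunE liftK.
  by apply/ffunP => i; rewrite !ffunE; case: unliftP => [j|] -> /=; rewrite ?ffunE.
apply: eq_bigr => -[j k] _ /=.
rewrite big_ord_recl mulrA /h ffunE unlift_none /=; congr (_ * _ * w _).
  by apply: eq_bigr => i _; rewrite ffunE liftK.
by apply/funext => i /=; rewrite ffunE /cons; case: unliftP.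
Qed.

Lemma alternating_sum (n : nat) (X : lmodType K) (J : finType)
    (w : ('I_n -> X) -> K^o) (c : 'I_n -> J -> K) (g : J -> X) :
  multilinear w -> Defs.alternating w ->
  w (fun i => \sum_j c i j *: g j) =
  \sum_(k : {ffun 'I_n -> J} | injectiveb k) (\prod_i c i (k i)) * w (g \o k).
Proof.
move=> wl wa; rewrite multilinear_sum// (bigID (fun k : {ffun _} => injectiveb k)) /=.
rewrite [X in _ + X]big1 ?addr0// => k /injectivePn[i [j ij kij]].
by rewrite (wa _ _ _ ij) ?mulr0 //= kij.
Qed.

End MultilinearExpansion.

(** * Injective functions as increasing tuples composed with permutations *)

Section InjectiveFunctions.
Variables (V : nmodType) (n N : nat).

(** Sorting the values of an injective [k] gives a unique increasing [s], and [k] is then [s] after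
    a permutation of the indices. *)
Lemma sum_injective_ffun (F : {ffun 'I_n -> 'I_N} -> V) :
  \sum_(k : {ffun 'I_n -> 'I_N} | injectiveb k) F k =
  \sum_(s : n.-tuple 'I_N | sorted ltn (map val s))
    \sum_(p : {ffun 'I_n -> 'I_n} | injectiveb p) F [ffun i => tnth s (p i)].
Proof.
pose r := relpre (val : 'I_N -> nat) leq.
pose srt (k : {ffun 'I_n -> 'I_N}) : n.-tuple 'I_N :=
  [tuple of sort r [tuple k i | i < n]].
have srt_perm k : perm_eq (srt k) [tuple k i | i < n] by rewrite perm_sort.
have srt_uniq (k : {ffun 'I_n -> 'I_N}) : injective k -> uniq (srt k).
  by move=> kI; rewrite (perm_uniq (srt_perm k)) map_inj_uniq ?enum_uniq.
have srt_sorted (k : {ffun _ -> _}) : injective k -> sorted ltn (map val (srt k)).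
  move=> kI; rewrite ltn_sorted_uniq_leq (map_inj_uniq val_inj) srt_uniq//=.
  by rewrite sorted_map; apply: sort_sorted => x y; apply: leq_total.
rewrite (partition_big srt (fun s : n.-tuple _ => sorted ltn (map val s))); last first.
  by move=> k /injectiveP; apply: srt_sorted.
apply: eq_bigr => s s_sorted.
have s_uniq : uniq s.
  by move: (ltn_sorted_uniq_leq (map val s)); rewrite s_sorted (map_inj_uniq val_inj)
    => /esym/andP[].
have s_inj : injective (tnth s) by apply/tuple_uniqP.
pose h (p : {ffun 'I_n -> 'I_n}) := [ffun i => tnth s (p i)].
pose Q := [pred p : {ffun 'I_n -> 'I_n} | injectiveb p].
have hI : injective h.
  move=> p q /ffunP hpq; apply/ffunP => i; apply: s_inj.
  by have := hpq i; rewrite !ffunE.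
(* The fibre of [srt] over [s] is exactly the injective image under [h] of the permutations. *)
transitivity (\sum_(k in h @: Q) F k).
  apply: eq_bigl => k; apply/idP/imsetP.
    move=> /andP[/injectiveP kI /eqP sk].
    have ks i : exists j, tnth s j = k i.
      have : k i \in srt k.
        by rewrite (perm_mem (srt_perm k)); apply: map_f; rewrite mem_enum.
      by rewrite sk => /tnthP[j ->]; exists j.
    have [p pk] := choice ks.
    exists (finfun p); last by apply/ffunP => i; rewrite !ffunE pk.
    by rewrite inE; apply/injectiveP => i j; rewrite !ffunE => pij; apply: kI;
       rewrite -!pk pij.
  case=> p; rewrite inE => /injectiveP pI ->.
  have hpI : injective (h p) by move=> i j; rewrite !ffunE => /s_inj/pI.
  apply/andP; split; first exact/injectiveP.
  (* Strictly sorted lists with the same members are equal; one inclusion suffices because the sizes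
     agree. *)
  have hsub : {subset srt (h p) <= s}.
    move=> x; rewrite (perm_mem (srt_perm _)) => /mapP[i _ ->].
    by rewrite ffunE mem_tnth.
  apply/eqP/val_inj/(inj_map val_inj)/(irr_sorted_eq ltn_trans ltnn) => //.
    exact: srt_sorted.
  have size_s : (size s <= size (srt (h p)))%N by rewrite !size_tuple.
  have [_ e] := uniq_min_size (srt_uniq _ hpI) hsub size_s.
  move=> x; apply/mapP/mapP => -[y ys ->]; exists y => //; first by rewrite -e.
  by rewrite e.
by rewrite big_imset //= => p q _ _; apply: hI.
Qed.

End InjectiveFunctions.

(** * Unconditional convergence from an exhaustion by finite sets *)

Section UnconditionalSums.
Variable R : realType.
Implicit Type I : choiceType.

Lemma partial_sumE I (V : zmodType) (u : I -> V) (J : {fset I}) :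
  summability.partial_sum u J = \sum_(i <- J) u i.
Proof. by rewrite big_seq_fsetE. Qed.

Lemma big_fset_subset I (V : zmodType) (u : I -> V) (J K : {fset I}) :
  (J `<=` K)%fset ->
  \sum_(i <- K) u i = \sum_(i <- J) u i + \sum_(i <- K | i \notin J) u i.
Proof.
move=> /fsubsetP JK; rewrite (bigID (mem J)) /=; congr (_ + _).
rewrite -big_filter; apply/perm_big/uniq_perm; rewrite ?filter_uniq ?fset_uniq//.
by move=> i; rewrite mem_filter andb_idr// => /JK.
Qed.

(* Boundedness of the absolute partial sums along the exhaustion makes the tails
   uniformly small, which upgrades convergence along [A] to convergence of the
   net of all finite partial sums. *)
Lemma has_sum_exhaustion I (u : I -> R[i]^o) (l : R[i]^o) (M : R[i])
    (A : nat -> {fset I}) :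
  (forall N N', (N <= N')%N -> (A N `<=` A N')%fset) ->
  (forall i, exists N, i \in A N) ->
  (forall N, \sum_(i <- A N) `|u i| <= M) ->
  (fun N => \sum_(i <- A N) u i) @ \oo --> l ->
  has_sum u l.
Proof.
move=> Amono Aexh AM Acvg.
have covered (J : seq I) : exists N, {subset J <= A N}.
  elim: J => [|i J [N JN]]; first by exists 0%N.
  have [N' iN'] := Aexh i; exists (maxn N N') => j; rewrite inE => /predU1P[->|/JN].
    by apply: (fsubsetP (Amono _ _ (leq_maxr _ _))).
  by apply: (fsubsetP (Amono _ _ (leq_maxl _ _))).
pose S N : R[i] := \sum_(i <- A N) `|u i|.
have S_tail N m : (N <= m)%N ->
    S m = S N + \sum_(i <- A m | i \notin A N) `|u i|.
  by move=> /Amono; apply: big_fset_subset.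
(* Monotone convergence is applied in [R], to the real parts of these real sums. *)
have S_real N : S N = (complex.Re (S N))%:C%C.
  by rewrite RRe_real// ger0_real// sumr_ge0.
have Re_ndec : nondecreasing_seq (fun N => complex.Re (S N)).
  move=> N m Nm; rewrite -lecR -!S_real (S_tail N m Nm) lerDl.
  by rewrite sumr_ge0.
have /cvg_ex[r Sr] : cvgn (fun N => complex.Re (S N)).
  apply: nondecreasing_is_cvgn => //; exists (complex.Re M) => _ [N _ <-].
  have := AM N; rewrite -[\sum_(i <- _) _]/(S N) lecE.
  by move=> /andP[].
have FT := @summability.totally_filter I.
apply/cvgrPdist_le => e e0.
have eR : e = (complex.Re e)%:C%C by rewrite RRe_real// gtr0_real.
have eR0 : 0 < complex.Re e by rewrite -ltcR -eR.
have e20 : 0 < e / 2 by rewrite divr_gt0.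
have eR20 : 0 < complex.Re e / 2 by rewrite divr_gt0.
move/cvgrPdist_le: Acvg => /(_ _ e20) H1.
move/cvgrPdist_le: (Sr) => /(_ _ eR20) H2.
have [N _ HN] := filterI H1 H2.
exists (A N) => // J /= AJ.
have [m0 Jm0] := covered J.
(* [A m] contains both [A N] and [J]: the error splits into the error at [A m] and the terms of
   [A m] outside [J], hence outside [A N], each at most [e / 2]. *)
pose m := maxn N m0.
have JAm : (J `<=` A m)%fset.
  by apply/fsubsetP => i /Jm0; apply: (fsubsetP (Amono _ _ (leq_maxr _ _))).
have [Hm _] := HN m (leq_maxl _ _).
have S_le_r k : complex.Re (S k) <= r.
  by have := nondecreasing_cvgn_le Re_ndec (cvgP _ Sr) k; rewrite (cvg_lim _ Sr).
have [_ HN2] := HN N (leqnn _).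
have tailN : \sum_(i <- A m | i \notin A N) `|u i| <= e / 2.
  rewrite -(addKr (S N) (\sum_(_ <- _ | _) _)) -S_tail ?leq_maxl//.
  rewrite addrC (S_real m) (S_real N) eR -rmorphB /=.
  rewrite -[2]/(2%:R) -(rmorph_nat (real_complex R) 2).
  rewrite -fmorphV -rmorphM lecR; apply: le_trans HN2.
  by rewrite ger0_norm ?subr_ge0// lerB.
rewrite partial_sumE.
rewrite [X in _ <= X](splitr e) -(addrNK (\sum_(i <- A m) u i) l) -addrA.
apply: (le_trans (ler_normD _ _)); apply: lerD => [//|].
rewrite (big_fset_subset u JAm) addrC addKr.
apply: (le_trans (ler_norm_sum _ _ _)); apply: le_trans tailN.
rewrite big_mkcond [leRHS]big_mkcond; apply: ler_sum => i _.
case: ifPn => iJ; last by case: ifP.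
by rewrite ifT//; apply: contra iJ; apply: (fsubsetP AJ).
Qed.

End UnconditionalSums.

(** * Finite exhaustion of the increasing tuples *)

Section IncreasingTuples.

(** Built from tuples over ['I_N] so that sums over it turn into those of [sum_injective_ffun]. *)
Definition bounded_increasing (n N : nat) : {fset increasing_tuple n} :=
  seq_fset tt (pmap insub [seq map_tuple val s | s : n.-tuple 'I_N]).

Lemma mem_bounded_increasing n N (s : increasing_tuple n) :
  (s \in bounded_increasing n N) = all (fun k => k < N)%N (val s).
Proof.
rewrite seq_fsetE mem_pmap_sub; apply/idP/allP => [|sN].
  by case/fintype.imageP => t _ -> k /mapP[i _ ->]; apply: ltn_ord.
have sN' i : (tnth (val s) i < N)%N by apply/sN/mem_tnth.
apply/fintype.imageP; exists [tuple Ordinal (sN' i) | i < n] => //.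
by apply: eq_from_tnth => i; rewrite tnth_map tnth_mktuple.
Qed.

Lemma bounded_increasing_mono n N N' : (N <= N')%N ->
  (bounded_increasing n N `<=` bounded_increasing n N')%fset.
Proof.
move=> NN'; apply/fsubsetP => s; rewrite !mem_bounded_increasing => /allP sN.
by apply/allP => k /sN kN; apply: leq_trans NN'.
Qed.

Lemma bounded_increasing_exhaustive n (s : increasing_tuple n) :
  exists N, s \in bounded_increasing n N.
Proof.
exists (\max_(k <- val s) k).+1; rewrite mem_bounded_increasing.
by apply/allP => k ks; rewrite ltnS; apply: (leq_bigmax_seq (F := fun k => k)).
Qed.

Lemma sum_bounded_increasing (V : nmodType) n N (F : n.-tuple nat -> V) :
  \sum_(s <- bounded_increasing n N) F (val s) =
  \sum_(s : n.-tuple 'I_N | sorted ltn (map val s)) F (map_tuple val s).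
Proof.
pose r : seq (n.-tuple nat) := [seq map_tuple val s | s : n.-tuple 'I_N].
have r_uniq : uniq r.
  rewrite map_inj_uniq ?enum_uniq// => s t st; apply: val_inj.
  exact: (inj_map val_inj (congr1 val st)).
rewrite (perm_big (pmap insub r)) /=; last first.
  by apply: (perm_trans (seq_fset_perm tt _)); rewrite undup_id ?pmap_sub_uniq.
rewrite -(big_map val xpredT F) pmap_filter; last exact: insubK.
rewrite big_filter big_image_cond /=; apply: eq_bigl => s.
by rewrite isSome_insub.
Qed.

End IncreasingTuples.

(** * Coordinatewise convergence in finite dimension *)

Section FiniteDimensionalTopology.
Variables (K : numFieldType) (V : vectType K).

Lemma cvg_mx_entries m n (T : Type) (F : set_system T) (FF : Filter F)
    (g : T -> 'M[K]_(m, n)) (M : 'M[K]_(m, n)) :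
  (forall i j, (fun t => g t i j : K^o) @ F --> (M i j : K^o)) -> g @ F --> M.
Proof.
move=> gM A [P MP PA].
have HP (i : 'I_m) (j : 'I_n) : F [set t | P i j (g t i j)] by apply: gM (MP i j).
have {}HP : F [set t | forall i j, P i j (g t i j)].
  apply: (@filter_forall _ _ (fun i t => forall j, P i j (g t i j)) F) => i.
  by apply: (@filter_forall _ _ (fun j t => P i j (g t i j)) F) => j; apply: HP.
by rewrite /nbhs /=; apply: filterS HP => t Pt; apply: PA.
Qed.

(** The topology is initial for [rVof], so open sets are preimages of open sets of rows, where
    convergence is entrywise. *)
Lemma cvg_fdspace (T : Type) (F : set_system T) (FF : Filter F)
    (g : T -> fdspace V) (v : fdspace V) :
  (forall i, (fun t => coord (vbasis {:V}) i (g t) : K^o) @ F -->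
             (coord (vbasis {:V}) i v : K^o)) ->
  g @ F --> v.
Proof.
move=> gv.
have gr : (fun t => rVof (vbasis {:V}) (g t)) @ F --> rVof (vbasis {:V}) v.
  apply: cvg_mx_entries => i j; rewrite (ord1 i).
  have := gv j; rewrite coord_rVof.
  under eq_fun do rewrite coord_rVof.
  by [].
move=> A; rewrite nbhsE => -[B [[C Copen CB] Bv] BA].
have /gr FC : nbhs (rVof (vbasis {:V}) v) C.
  by apply: open_nbhs_nbhs; split=> //; move: Bv; rewrite -CB.
rewrite -[_ C]/(F [set t | C (rVof (vbasis {:V}) (g t))]) in FC.
by rewrite /nbhs /=; apply: filterS FC => t Ct; apply: BA; rewrite -CB.
Qed.

Lemma coord_fdspace_continuous i :
  continuous (coord (vbasis {:V}) i : fdspace V -> K^o).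
Proof.
move=> v; have -> : (coord (vbasis {:V}) i : fdspace V -> K^o) =
    (fun M : 'rV[K]_(\dim {:V}) => M 0 i : K^o) \o rVof (vbasis {:V}).
  by apply/funext => u /=; rewrite coord_rVof.
apply: continuous_comp; first exact: (@initial_continuous _ _ (rVof (vbasis {:V}))).
exact: coord_continuous.
Qed.

End FiniteDimensionalTopology.

(** * Reduction of vector sums to scalar sums *)

Section FiniteDimensionalSums.
Variable K : numFieldType.

Lemma cvg_bigD (T : Type) (F : set_system T) (FF : Filter F) (J : Type)
    (r : seq J) (g : J -> T -> K^o) (a : J -> K^o) :
  (forall j, g j @ F --> a j) ->
  (fun t => \sum_(j <- r) g j t) @ F --> \sum_(j <- r) a j.
Proof.
move=> ga; elim: r => [|j r IH].
  by under eq_fun do rewrite big_nil; rewrite big_nil; apply: cvg_cst.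
under eq_fun do rewrite big_cons; rewrite big_cons.
exact: cvgD.
Qed.

Lemma cvg_bigM (T : Type) (F : set_system T) (FF : Filter F)
    (J : Type) (r : seq J) (g : J -> T -> K^o) (a : J -> K^o) :
  (forall j, g j @ F --> a j) ->
  (fun t => \prod_(j <- r) (g j t : K) : K^o) @ F -->
  (\prod_(j <- r) (a j : K) : K^o).
Proof.
move=> ga; elim: r => [|j r IH].
  by under eq_fun do rewrite big_nil; rewrite big_nil; apply: cvg_cst.
under eq_fun do rewrite big_cons; rewrite big_cons.
exact: cvgM.
Qed.

(* The functionals need only separate points: a left inverse of the injection
   v |-> (ev j v)_j turns their values into a linear expansion of v. *)
Lemma separating_expansion (V : vectType K) (J : finType)
    (ev : J -> {linear V -> K^o}) :
  (forall v, (forall j, ev j v = 0) -> v = 0) ->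
  exists b : J -> V, forall v, v = \sum_j ev j v *: b j.
Proof.
move=> sep.
pose g v : {ffun J -> K^o} := [ffun j => ev j v].
have g_lin : linear g by move=> a u v; apply/ffunP => j; rewrite !ffunE linearP.
pose gm := GRing.isLinear.Build K V {ffun J -> K^o} _ g g_lin.
pose gL : {linear V -> {ffun J -> K^o}} := HB.pack g gm.
pose G := linfun gL.
have GE v : G v = g v by rewrite lfunE.
have G0 : lker G == 0%VS.
  apply/lker0P => v v'; rewrite !GE => /ffunP gv; apply/subr0_eq/sep => j.
  by have := gv j; rewrite !ffunE linearB /= => ->; rewrite subrr.
pose delta j : {ffun J -> K^o} := [ffun k => (k == j)%:R].
exists (fun j => (G^-1)%VF (delta j)) => v.
rewrite -{1}(lker0_lfunK G0 v).
have -> : G v = \sum_j ev j v *: delta j.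
  rewrite GE; apply/ffunP => k; rewrite sum_ffunE ffunE (bigD1 k)//=.
  rewrite !ffunE eqxx big1 => [|j jk].
    by rewrite addr0 /GRing.scale /= mulr1.
  by rewrite !ffunE eq_sym (negPf jk) scaler0.
by rewrite linear_sum; apply: eq_bigr => j _; rewrite linearZ.
Qed.

(** Each coordinate is a fixed finite linear combination of the values [ev j], so it inherits their
    convergence. *)
Lemma has_sum_fdspace (V : vectType K) (I : choiceType) (J : finType)
    (ev : J -> {linear V -> K^o}) (u : I -> fdspace V) (l : fdspace V) :
  (forall v, (forall j, ev j v = 0) -> v = 0) ->
  (forall j, has_sum (fun i => ev j (u i) : K^o) (ev j l)) ->
  has_sum u l.
Proof.
move=> /separating_expansion[b bE] evu.
have FT := @summability.totally_filter I.
have coordE v i : coord (vbasis {:V}) i v = \sum_j ev j v * coord (vbasis {:V}) i (b j).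
  by rewrite {1}(bE v) linear_sum; apply: eq_bigr => j _; rewrite linearZ.
apply: cvg_fdspace => i.
under eq_fun do rewrite coordE.
rewrite coordE; apply: cvg_bigD => j.
apply: cvgMr_tmp.
have -> : (fun A => ev j (summability.partial_sum u A) : K^o) =
    summability.partial_sum (fun i => ev j (u i) : K^o).
  by apply/funext => A; rewrite /summability.partial_sum linear_sum.
exact: evu.
Qed.

End FiniteDimensionalSums.

(** * Fourier sums and Bessel inequalities *)

Section FourierCoefficients.
Variables (R : realType) (H : hilbertType R) (f : orthonormal_basis H).

Definition fourier_sum N (x : H) := \sum_(k < N) '[x, f k] *: f k.

Lemma inner_sum_basis N (c : 'I_N -> R[i]) (k : 'I_N) :
  '[\sum_(j < N) c j *: f j, f k] = c k.
Proof.
rewrite linear_sumlz (bigD1 k)//= linearZl_LR /= basis_orthonormal eqxx mulr1.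
rewrite big1 ?addr0// => j jk; rewrite linearZl_LR /= basis_orthonormal.
by rewrite (inj_eq val_inj) (negPf jk) mulr0.
Qed.

Lemma norm_sum_basis N (c : 'I_N -> R[i]) :
  `|\sum_(j < N) c j *: f j| ^+ 2 = \sum_(j < N) `|c j| ^+ 2.
Proof.
rewrite inner_norm [in LHS]linear_sumr; apply: eq_bigr => k _.
by rewrite linearZr_LR /= inner_sum_basis mulrC -normCK.
Qed.

Lemma inner_residual N x (c : 'I_N -> R[i]) :
  '[x - fourier_sum N x, \sum_(j < N) c j *: f j] = 0.
Proof.
rewrite linear_sumr big1// => k _; rewrite linearZr_LR /= linearBl.
apply/eqP; rewrite mulf_eq0 subr_eq0.
rewrite [X in _ || (_ == X)](inner_sum_basis (fun j => '[x, f j])).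
by rewrite eqxx orbT.
Qed.

Lemma pythagoras (x y : H) : '[x, y] = 0 ->
  `|x + y| ^+ 2 = `|x| ^+ 2 + `|y| ^+ 2.
Proof. by move=> xy; rewrite !inner_norm hnormDd. Qed.

(** The left side is the squared norm of the Fourier sum, which is orthogonal to the residual. *)
Lemma bessel N x : \sum_(k < N) `|'[x, f k]| ^+ 2 <= `|x| ^+ 2.
Proof.
rewrite -norm_sum_basis -[in leRHS](subrK (fourier_sum N x) x).
by rewrite pythagoras ?inner_residual// lerDr exprn_ge0.
Qed.

Lemma best_approximation N x (c : 'I_N -> R[i]) :
  `|x - fourier_sum N x| <= `|x - \sum_(j < N) c j *: f j|.
Proof.
rewrite -(@ler_pXn2r _ 2)// ?nnegrE//.
rewrite -[X in _ <= `|X - _| ^+ _](subrK (fourier_sum N x) x) -addrA.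
have -> : fourier_sum N x - \sum_(j < N) c j *: f j =
    \sum_(j < N) ('[x, f j] - c j) *: f j.
  by rewrite /fourier_sum -sumrB; apply: eq_bigr => j _; rewrite scalerBl.
by rewrite [leRHS]pythagoras ?inner_residual// lerDl exprn_ge0.
Qed.

(** Totality gives one combination of the first [m] vectors close to [x]; for [N >= m] the Fourier
    sum is at least as close. *)
Lemma fourier_sum_cvg x : fourier_sum ^~ x @ \oo --> x.
Proof.
apply/cvgrPdist_lt => e e0.
have : closure [set x | exists m (c : 'I_m -> R[i]),
    x = \sum_(k < m) c k *: f k] x by rewrite basis_total.
move=> /(_ _ (nbhsx_ballx x e e0)) [_ [[m [c ->]]]].
rewrite -ball_normE /= => xc.
exists m => // N /= mN; apply: le_lt_trans xc.
(* Coefficients from index [m] on are padded with the default 0. *)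
pose d (k : 'I_N) := oapp c 0 (insub (val k)).
have -> : \sum_(k < m) c k *: f k = \sum_(k < N) d k *: f k.
  rewrite (eq_bigr (fun k : 'I_m => oapp c 0 (insub (val k)) *: f k)); last first.
    by move=> k _; rewrite valK.
  rewrite (big_ord_widen N (fun k => oapp c 0 (insub k) *: f k) mN) big_mkcond.
  apply: eq_bigr => k _; rewrite /d; case: ltnP => // mk.
  by rewrite insubN ?scale0r// -leqNgt.
exact: best_approximation.
Qed.

Lemma continuous_functional_bounded (a : {linear H -> R[i]^o}) :
  continuous a -> exists2 M : R[i], 0 <= M & forall x, `|a x| <= M * `|x|.
Proof.
move=> /linear_bounded_continuous/linear_boundedP/pinfty_ex_gt0[M M0 aM].
by exists M => //; apply: ltW.
Qed.

Lemma bessel_functional (a : {linear H -> R[i]^o}) :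
  continuous a -> exists2 M, 0 <= M & forall N, \sum_(k < N) `|a (f k)| ^+ 2 <= M.
Proof.
move=> /continuous_functional_bounded[M M0 aM]; exists (M ^+ 2) => [|N].
  exact: exprn_ge0.
set S := \sum_(k < N) _.
have S0 : 0 <= S by apply: sumr_ge0 => k _; apply: exprn_ge0.
(* This test vector has both [a y] and its squared norm equal to [S]; boundedness gives
   [S * S <= M ^+ 2 * S], and [S] cancels. *)
pose y := \sum_(k < N) (a (f k))^* *: f k.
have ay : a y = S.
  rewrite linear_sum; apply: eq_bigr => k _.
  by rewrite linearZ /= normCK mulrC.
have ny : `|y| ^+ 2 = S.
  by rewrite norm_sum_basis; apply: eq_bigr => k _; rewrite norm_conjC.
have [->|Sn0] := eqVneq S 0; first exact: exprn_ge0.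
have Sp : 0 < S by rewrite lt_def Sn0.
rewrite -(ler_pM2r Sp) -[X in _ <= _ * X]ny -exprMn -expr2.
have := aM y; rewrite ay ger0_norm// => SM.
by rewrite ler_pXn2r// ?nnegrE// mulr_ge0.
Qed.

End FourierCoefficients.

(** * Alternating forms in coordinates *)

Lemma altform_coord (K : fieldType) (n : nat) (W : vectType K)
    (w : altform n W) (y : 'I_n -> W) :
  w y = \sum_(k : {ffun 'I_n -> 'I_(\dim {:W})})
    (\prod_i coord (vbasis {:W}) (k i) (y i)) * w (fun i => (vbasis {:W})`_(k i)).
Proof.
have /asboolP[wl _] := altvalP w.
rewrite -(multilinear_sum (fun i j => coord (vbasis {:W}) j (y i))
  (fun j : 'I_(\dim {:W}) => (vbasis {:W})`_j) wl).
by congr (altval w _); apply/funext => i; rewrite -coord_vbasis ?memvf.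
Qed.

Lemma altform_bound (K : numFieldType) (n : nat) (W : vectType K)
    (w : altform n W) :
  exists2 C : K, 0 <= C & forall y,
    `|w y| <= C * \prod_i \sum_l `|coord (vbasis {:W}) l (y i)|.
Proof.
pose e (k : {ffun 'I_n -> 'I_(\dim {:W})}) : K := w (fun i => (vbasis {:W})`_(k i)).
(* Each value of the form on a basis tuple is bounded by the sum of all of them in absolute
   value. *)
exists (\sum_k `|e k|) => [|y]; first by rewrite sumr_ge0.
rewrite altform_coord (bigA_distr_bigA (fun i l => `|coord (vbasis {:W}) l (y i)|)).
rewrite mulr_sumr; apply: le_trans (ler_norm_sum _ _ _) _.
apply: ler_sum => k _; rewrite normrM mulrC normr_prod ler_wpM2r//.
  by apply: prodr_ge0.
by rewrite (bigD1 k)//= lerDl sumr_ge0.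
Qed.

(** * The scalar sum over coordinate subspaces *)

Section CauchyBinetSum.
Variables (R : realType) (H : hilbertType R) (f : orthonormal_basis H) (n : nat).

(** The projection is some combination of the chosen basis vectors; orthogonality of the residual to
    each of them determines the coefficients. *)
Lemma inclusion_projection (s : increasing_tuple n) (x : H) :
  inclusion f s (projection f s x) =
  \sum_p '[x, f (tnth (val s) p)] *: f (tnth (val s) p).
Proof.
have /asboolP[c cE] := coord_valP (projection f s x).
rewrite -[LHS]/(coord_val (projection f s x)) cE.
apply: eq_bigr => p _; congr (_ *: _).
have /rowP/(_ p) := inner_row_sum f s c; rewrite -cE !mxE => <-.
have fP : f (tnth (val s) p) \in coord_pred f s.
  apply/asboolP; exists (fun q => (q == p)%:R).
  rewrite (bigD1 p)//= eqxx scale1r big1 ?addr0// => q qp.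
  by rewrite (negPf qp) scale0r.
have := projectionP x (CoordSubspace fP).
by rewrite linearBl /= => /subr0_eq.
Qed.

Variables (W : vectType R[i]) (A : {linear H -> W}).
Hypothesis A_cont : continuous (A : H -> fdspace W).
Variables (w : altform n W) (h : 'I_n -> H).

(** Defined on bare tuples so that [sum_bounded_increasing] applies. *)
Let cterm (t : n.-tuple nat) : R[i]^o :=
  w (fun i => \sum_p '[h i, f (tnth t p)] *: A (f (tnth t p))).

Let gterm N (k : {ffun 'I_n -> 'I_N}) : R[i] :=
  (\prod_i '[h i, f (k i)]) * w (fun i => A (f (k i))).

Let cterm_map_val N (t : n.-tuple 'I_N) :
  cterm (map_tuple val t) =
  \sum_(p : {ffun 'I_n -> 'I_n} | injectiveb p) gterm [ffun i => tnth t (p i)].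
Proof.
have /asboolP[wl wa] := altvalP w.
rewrite /cterm (alternating_sum (fun i p => '[h i, f (tnth (map_tuple val t) p)])
  (fun p => A (f (tnth (map_tuple val t) p))) wl wa).
apply: eq_bigr => p _; rewrite /gterm; congr (_ * altval w _).
  by apply: eq_bigr => i _; rewrite ffunE tnth_map.
by apply/funext => i /=; rewrite ffunE tnth_map.
Qed.

(** Expanding [w] at the Fourier sums leaves only injective index choices; grouped by image, they
    give the terms [cterm]. *)
Let sum_cterm N :
  \sum_(s <- bounded_increasing n N) cterm (val s) =
  w (fun i => A (fourier_sum f N (h i))).
Proof.
have /asboolP[wl wa] := altvalP w.
rewrite sum_bounded_increasing; under eq_bigr do rewrite cterm_map_val.
rewrite -sum_injective_ffun.
rewrite -(alternating_sum (fun i (k : 'I_N) => '[h i, f k]) (fun k => A (f k)) wl wa).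
congr (altval w _); apply/funext => i; rewrite /fourier_sum linear_sum.
by apply: eq_bigr => k _; rewrite linearZ.
Qed.

Let coordA l : {linear H -> R[i]^o} := (coord (vbasis {:W}) l \o A).

Let coordA_cont l : continuous (coordA l).
Proof.
move=> x; apply: (@continuous_comp _ _ _ (A : H -> fdspace W)).
  exact: A_cont.
exact: coord_fdspace_continuous.
Qed.

Let sum_cterm_cvg :
  (fun N => \sum_(s <- bounded_increasing n N) cterm (val s)) @ \oo -->
  (w (fun i => A (h i)) : R[i]^o).
Proof.
under eq_fun do rewrite sum_cterm altform_coord.
rewrite altform_coord; apply: cvg_bigD => k; apply: cvgMr_tmp.
apply: cvg_bigM => i.
apply: (@cvg_comp _ _ _ (fun N => fourier_sum f N (h i)) (coordA (k i))).
  exact: fourier_sum_cvg.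
exact: coordA_cont.
Qed.

(** The square of the larger factor already dominates; nonnegative elements of [R[i]] are real,
    hence comparable. *)
Let ler_mul_sqr (x y : R[i]) : 0 <= x -> 0 <= y -> x * y <= x ^+ 2 + y ^+ 2.
Proof.
move=> x0 y0.
have /orP[xy|yx] := real_leVge (ger0_real x0) (ger0_real y0).
  by rewrite (le_trans (ler_wpM2r y0 xy))// -expr2 lerDr exprn_ge0.
by rewrite (le_trans (ler_wpM2l x0 yx))// -expr2 lerDl exprn_ge0.
Qed.

Let sum_norm_bound :
  exists M, forall N, \sum_(s <- bounded_increasing n N) `|cterm (val s)| <= M.
Proof.
have [C C0 wC] := altform_bound w.
have /choice[Ma MaP] l : exists M, forall N, \sum_(k < N) `|coordA l (f k)| ^+ 2 <= M.
  by have [M _ HM] := bessel_functional f (@coordA_cont l); exists M.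
(* [C] bounds the form; the two summands are the Bessel bounds for [h i] and for the coordinate
   functional [coordA l]. *)
exists (C * \prod_i \sum_l (`|h i| ^+ 2 + Ma l)) => N.
rewrite (sum_bounded_increasing N (fun t => `|cterm t|)).
apply: (@le_trans _ _ (\sum_(k : {ffun 'I_n -> 'I_N}) `|gterm k|)).
  (* Enlarging the sum from injective [k] to all [k] lets it factor later as a product over [i]. *)
  apply: (@le_trans _ _ (\sum_(k : {ffun 'I_n -> 'I_N} | injectiveb k) `|gterm k|)).
    rewrite sum_injective_ffun; apply: ler_sum => t _.
    by rewrite cterm_map_val ler_norm_sum.
  by rewrite [leRHS](bigID (fun k : {ffun 'I_n -> 'I_N} => injectiveb k))/= lerDl sumr_ge0.
pose g i (j : 'I_N) := \sum_l `|'[h i, f j]| * `|coordA l (f j)|.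
apply: (@le_trans _ _ (C * \sum_(k : {ffun 'I_n -> 'I_N}) \prod_i g i (k i))).
  rewrite mulr_sumr; apply: ler_sum => k _.
  rewrite /gterm normrM normr_prod.
  apply: (le_trans (ler_wpM2l _ (wC _))); first by apply: prodr_ge0.
  rewrite mulrCA ler_wpM2l// -big_split /=.
  by apply: ler_prod => i _; rewrite mulr_ge0 ?sumr_ge0//= mulr_sumr.
rewrite -(bigA_distr_bigA g) ler_wpM2l//; apply: ler_prod => i _.
apply/andP; split.
  by apply: sumr_ge0 => j _; apply: sumr_ge0 => l _; rewrite mulr_ge0.
rewrite /g exchange_big /=; apply: ler_sum => l _.
apply: le_trans (lerD (bessel f N (h i)) (MaP l N)).
by rewrite -big_split /=; apply: ler_sum => j _; apply: ler_mul_sqr.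
Qed.

Lemma has_sum_altform :
  has_sum
    (fun s : increasing_tuple n =>
       w (fun i => A (inclusion f s (projection f s (h i)))) : R[i]^o)
    (w (fun i => A (h i))).
Proof.
have -> : (fun s : increasing_tuple n =>
      w (fun i => A (inclusion f s (projection f s (h i)))) : R[i]^o) =
    (fun s => cterm (val s)).
  apply/funext => s; rewrite /cterm; congr (altval w _); apply/funext => i.
  rewrite inclusion_projection linear_sum.
  by apply: eq_bigr => p _; rewrite linearZ.
have [M HM] := sum_norm_bound.
apply: (has_sum_exhaustion (@bounded_increasing_mono n)
  (@bounded_increasing_exhaustive n) HM sum_cterm_cvg).
Qed.

End CauchyBinetSum.

Arguments has_sum_altform {R H} f {n W A} A_cont w h.

Lemma eq_has_sum (I : choiceType) (V : PreTopologicalZmodule.type)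
    (u v : I -> V) (l : V) : u =1 v -> has_sum u l -> has_sum v l.
Proof. by move=> /funext ->. Qed.
Arguments eq_has_sum {I V u v l} uv ul.

(** * Sums of maps between spaces of forms *)

Section PullbackSums.
Variables (K : numFieldType) (n : nat).

(** Evaluations at a basis form and a basis tuple are finite in number and separate points, since a
    form is determined by its values on basis tuples. *)
Lemma has_sum_Hom_altform (X Y : vectType K) (I : choiceType)
    (u : I -> fdspace 'Hom(altform n X, altform n Y))
    (l : fdspace 'Hom(altform n X, altform n Y)) :
  (forall w y, has_sum (fun s => (u s : 'Hom(_, _)) w y : K^o)
                       ((l : 'Hom(_, _)) w y)) ->
  has_sum u l.
Proof.
move=> ul.
pose J := ('I_(\dim {:altform n X}) * {ffun 'I_n -> 'I_(\dim {:Y})})%type.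
pose ev (j : J) (T : 'Hom(altform n X, altform n Y)) : K^o :=
  T (vbasis {:altform n X})`_j.1 (fun i => (vbasis {:Y})`_(j.2 i)).
have ev_lin j : linear (ev j) by move=> a S T; rewrite /ev add_lfunE scale_lfunE.
pose evm j := GRing.isLinear.Build K _ K^o _ (ev j) (ev_lin j).
pose evL j : {linear 'Hom(altform n X, altform n Y) -> K^o} := HB.pack (ev j) (evm j).
apply: (has_sum_fdspace (ev := evL)) => [T T0|j]; last exact: ul.
apply/lfunP => w; rewrite zero_lfunE (coord_vbasis (memvf w)) linear_sum.
apply: big1 => p _; rewrite linearZ /=; apply/eqP; rewrite scaler_eq0; apply/orP; right.
apply/eqP/val_inj/funext => y /=; rewrite altform_coord big1// => k _.
by rewrite [altval _ _](T0 (p, k)) mulr0.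
Qed.

End PullbackSums.

(** * The determinant as an alternating form *)

Section Determinants.
Variables (K : fieldType) (U : vectType K).
Let e := vbasis {:U}.

Lemma ldetE (F : {linear U -> U}) : ldet F = \det (\matrix_(i, j) coord e j (F e`_i)).
Proof.
rewrite /ldet; congr (\det _); apply/matrixP => i j.
by rewrite !mxE /= vecof_delta lfunE /= coord_rVof.
Qed.

Lemma ldet_comp (F G : {linear U -> U}) : ldet (F \o G) = ldet F * ldet G.
Proof.
(* Matrices act on rows, so composition reverses the product. *)
rewrite /ldet mulrC -det_mulmx -mxof_comp; last exact: vbasisP.
by congr (\det (mxof _ _ _)); apply/lfunP => x; rewrite comp_lfunE !lfunE.
Qed.

Lemma det_altpred :
  (fun y : 'I_(\dim {:U}) -> U => \det (\matrix_(i, j) coord e j (y i)) : K^o)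
    \in @altpred K (\dim {:U}) U.
Proof.
apply/asboolP; split=> [y i a u v|y i j ij yij].
  (* The second row gets the explicit coefficient 1. *)
  rewrite -[X in _ = _ + X]mul1r; apply: (@determinant_multilinear _ _ _ _ _ i).
  - by apply/rowP => j; rewrite !mxE /= eqxx linearP /= mul1r.
  - by apply/matrixP => k j; rewrite !mxE /= eq_sym (negPf (neq_lift _ _)).
  - by apply/matrixP => k j; rewrite !mxE /= eq_sym (negPf (neq_lift _ _)).
by apply: (determinant_alternate ij) => k; rewrite !mxE yij.
Qed.

Definition det_altform : altform (\dim {:U}) U := AltForm det_altpred.

Lemma det_altformE (F : {linear U -> U}) : det_altform (fun i => F e`_i) = ldet F.
Proof. by rewrite ldetE. Qed.

End Determinants.

(** * The three summation formulas *)

Theorem theorem2 (R : realType) (H : hilbertType R) (f : orthonormal_basis H)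
    (n : nat) (n_gt0 : (0 < n)%N)
    (U : vectType R[i]) (B : {linear U -> H})
    (B_cont : continuous (B : fdspace U -> H)) :
  (forall (W : vectType R[i]) (A : {linear H -> W}),
      continuous (A : H -> fdspace W) ->
      has_sum
        (fun s : increasing_tuple n =>
           (pullback n (projection f s \o B) \o
              pullback n (A \o inclusion f s))%VF
             : fdspace 'Hom(altform n W, altform n U))
        (pullback n (A \o B))) /\
  (forall (A : {linear H -> U}),
      continuous (A : H -> fdspace U) ->
      \dim {:U} = n ->
      forall phi : forall s : increasing_tuple n, 'Hom(coord_subspace f s, U),
        (forall s, bijective (phi s)) ->
        has_sum
          (fun s : increasing_tuple n =>
             (pullback n (phi s \o projection f s \o B) \o
                pullback n (A \o inclusion f s \o (phi s)^-1%VF))%VF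
               : fdspace 'Hom(altform n U, altform n U))
          (pullback n (A \o B)) /\
        has_sum
          (fun s : increasing_tuple n =>
             ldet (phi s \o projection f s \o B) *
             ldet (A \o inclusion f s \o (phi s)^-1%VF) : R[i]^o)
          (ldet (A \o B))).
Proof.
have inv_phi (U' : vectType R[i]) s (p : 'Hom(coord_subspace f s, U')) x :
    bijective p -> (p^-1)%VF (p x) = x.
  by move=> /bij_inj/lker0P p0; rewrite (lker0_lfunK p0).
split=> [W A A_cont|A A_cont dimU phi phi_bij].
  apply: has_sum_Hom_altform => w y; rewrite pullbackE.
  apply: (eq_has_sum _ (has_sum_altform f A_cont w (B \o y))) => s.
  by rewrite comp_lfunE !pullbackE.
split.
  apply: has_sum_Hom_altform => w y; rewrite pullbackE.
  apply: (eq_has_sum _ (has_sum_altform f A_cont w (B \o y))) => s.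
  rewrite comp_lfunE !pullbackE; congr (altval w _); apply/funext => i /=.
  by rewrite inv_phi.
suff: has_sum (fun s : increasing_tuple n =>
    ldet (A \o inclusion f s \o projection f s \o B) : R[i]^o) (ldet (A \o B)).
  (* Swapping the two determinants makes the inverse of [phi s] meet [phi s] in the composite. *)
  apply: eq_has_sum => s; rewrite [RHS]mulrC -ldet_comp !ldetE.
  by congr (\det _); apply/matrixP => i j; rewrite !mxE /= inv_phi.
(* Replacing [n] by the dimension of [U] makes [det_altform U] a form of the right degree. *)
case: n / dimU {phi phi_bij n_gt0}.
rewrite -(det_altformE (A \o B)).
have := has_sum_altform f A_cont (det_altform U) (fun i => B (vbasis {:U})`_i).
apply: eq_has_sum => s.
exact: (det_altformE (A \o inclusion f s \o projection f s \o B)).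
Qed.
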